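(* Let $p=|\mathcal{I}_H|>k$ and let $i_0\in\{0,1,\dots,k-1\}$ be such that $f(a_L+(i_0+1)a_H)-f(a_L+i_0a_H)\le\frac{f(ka_H)-f(i_0a_H)}{k-i_0}$. If the separation inequality $w\ge\sum_{i=1}^{i_0}\rho_ix_i+\sum_{i=i_0+1}^{p}\psi x_i$ is facet-defining for $\mathrm{conv}(\mathcal{P}^1_k(\mathcal{I}_H))$, then the higher-separation inequality (higher-SI) $w\ge\sum_{i=1}^{i_0}\rho_ix_i+\sum_{i=i_0+1}^{p}\psi x_i+\sum_{j=p+1}^n\gamma_jx_j$ lifted from it is facet-defining for $\mathrm{conv}(\mathcal{P}^2_k)$.
   Context: $[j]=\{1,\dots,j\}$. $N=[n]$, $k\ge1$, and $f:\mathbb{R}\to\mathbb{R}$ is concave with $f(0)=0$. The weight vector $a\in\mathbb{R}^n_+$ has exactly two distinct values $0\le a_L<a_H$; the items are indexed so that $\mathcal{I}_H=\{i:a_i=a_H\}=[p]$ and $\mathcal{I}_L=\{i:a_i=a_L\}=\{p+1,\dots,n\}$, with $p>k$. The sets are $\mathcal{P}^2_k=\{(w,x)\in\mathbb{R}\times\{0,1\}^n: w\ge f(\sum_{i=1}^na_ix_i),\ \sum_{i=1}^nx_i\le k\}$ and $\mathcal{P}^1_k(\mathcal{I}_H)=\{(w,x)\in\mathbb{R}\times\{0,1\}^{\mathcal{I}_H}: w\ge f(a_H\sum_{i\in\mathcal{I}_H}x_i),\ \sum_{i\in\mathcal{I}_H}x_i\le k\}$. Here $\rho_i=f(ia_H)-f((i-1)a_H)$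 and $\psi=\frac{f(ka_H)-f(i_0a_H)}{k-i_0}$. The coefficients $\gamma_j$ are the exact lifting coefficients: for $j=p+1,\dots,n$ recursively $\gamma_j=\min\{\gamma^X: X\subseteq[j-1],\ |X|\le k-1\}$, with $$\gamma^X=f\Big(a_L+\sum_{i\in X}a_i\Big)-\sum_{i\in X,\,i\le i_0}\rho_i-\sum_{i\in X,\,i_0<i\le p}\psi-\sum_{i\in X,\,i>p}\gamma_i .$$ *)

(* Defs.v *)
From HB Require Import structures.
From mathcomp Require Import boolp classical_sets reals convex.
From mathcomp Require Import all_boot all_order all_algebra.

Set Implicit Arguments.
Unset Strict Implicit.
Unset Printing Implicit Defensive.

Import Order.TTheory GRing.Theory Num.Theory.
Local Open Scope ring_scope.

(* The items 1, ..., n are the elements of 'I_n shifted by one: the ordinal i  *)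
(* stands for item i.+1. So item <= m reads (i < m)%N, item > m reads          *)
(* (m <= i)%N, and the items preceding that of j are the ordinals i < j.       *)

Definition concave_function (R : realType) (f : R -> R) : Prop :=
  @convex_function R R^o [set: R]%classic (fun x => - f x).

Section Polyhedra.
Variable R : realType.

(* The points (w, x) of R x R^m. *)
Definition point (m : nat) : vectType R := (R^o * 'rV[R]_m)%type.

Definition conv_hull (V : lmodType R) (A : set V) : set V :=
  smallest (@convex_set R V) A.

Definition aff_indep (V : vectType R) (s : seq V) : bool :=
  free [seq v - head 0 s | v <- behead s].

(* The affine dimension of A is d: one less than the maximal number of         *)
(* affinely independent points of A. The empty set has no dimension here.      *)
Definition has_dim (V : vectType R) (A : set V) (d : nat) : Prop :=
  (exists s : seq V,
     [/\ size s = d.+1, aff_indep s & forall v, v \in s -> A v]) /\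
  (forall s : seq V,
     aff_indep s -> (forall v, v \in s -> A v) -> (size s <= d.+1)%N).

(* w >= l x, where l is a linear form, is facet-defining for the polyhedron C: *)
(* it is valid for C, and the face it induces has dimension dim C - 1.         *)
Definition facet_defining (m : nat) (C : set (point m)) (l : 'rV[R]_m -> R) :
    Prop :=
  (forall z : point m, C z -> l z.2 <= z.1) /\
  exists d : nat, has_dim C d.+1 /\
    has_dim [set z : point m | C z /\ z.1 = l z.2]%classic d.

End Polyhedra.

Section Sets.
Variables (R : realType) (f : R -> R) (k : nat).

Definition binary (m : nat) (x : 'rV[R]_m) : Prop :=
  forall i, x 0 i = 0 \/ x 0 i = 1.

Definition P2 (n : nat) (a : 'rV[R]_n) : set (point R n) :=
  [set z | [/\ binary z.2, f (\sum_(i < n) a 0 i * z.2 0 i) <= z.1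
             & \sum_(i < n) z.2 0 i <= k%:R]]%classic.

(* P1 is the set for the items of I_H = [p], so R^(I_H) is 'rV[R]_p. *)
Definition P1 (p : nat) (aH : R) : set (point R p) :=
  [set z | [/\ binary z.2, f (aH * \sum_(i < p) z.2 0 i) <= z.1
             & \sum_(i < p) z.2 0 i <= k%:R]]%classic.

End Sets.

Section Coefficients.
Variables (R : realType) (f : R -> R) (k i0 : nat) (aH : R).

(* i >= 1 is an item, not its ordinal. *)
Definition rho (i : nat) : R := f (i%:R * aH) - f ((i%:R - 1) * aH).

Definition psi : R := (f (k%:R * aH) - f (i0%:R * aH)) / (k%:R - i0%:R).

Variables (n p : nat) (a : 'rV[R]_n) (aL : R).

Definition gammaX (gamma : 'I_n -> R) (X : {set 'I_n}) : R :=
  f (aL + \sum_(i in X) a 0 i)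
  - \sum_(i in X | (i < i0)%N) rho i.+1
  - \sum_(i in X | (i0 <= i < p)%N) psi
  - \sum_(i in X | (p <= i)%N) gamma i.

Definition admissible (j : 'I_n) (X : {set 'I_n}) : bool :=
  (X \subset [set i : 'I_n | (i < j)%N]) && (#|X| <= k.-1)%N.

(* gamma j is the minimum of the gammaX over admissible X; these only involve  *)
(* gamma i for i < j, so this recursion determines gamma on the items > p.     *)
Definition exact_lifting (gamma : 'I_n -> R) : Prop :=
  forall j : 'I_n, (p <= j)%N ->
    (exists2 X, admissible j X & gamma j = gammaX gamma X) /\
    (forall X, admissible j X -> gamma j <= gammaX gamma X).

Lemma eq_gammaX (g h : 'I_n -> R) (j : 'I_n) (X : {set 'I_n}) :
  (forall i : 'I_n, (i < j)%N -> g i = h i) -> admissible j X ->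
  gammaX g X = gammaX h X.
Proof.
move=> gh /andP[/subsetP sX _]; congr (_ - _).
by apply: eq_bigr => i /andP[/sX]; rewrite inE => /gh.
Qed.

Lemma exact_lifting_exists : exists gamma, exact_lifting gamma.
Proof.
pose ok (g : 'I_n -> R) (j : 'I_n) :=
  (exists2 X, admissible j X & g j = gammaX g X) /\
  (forall X, admissible j X -> g j <= gammaX g X).
suff H m : exists g : 'I_n -> R, forall j : 'I_n, (j < m)%N -> ok g j.
  by have [g gP] := H n; exists g => j _; apply: gP.
elim: m => [|m [g gP]]; first by exists (fun=> 0).
pose g' (j : 'I_n) := if (j < m)%N then g j else
  gammaX g [arg min_(X < set0 | admissible j X) gammaX g X]%O.
have gg' (i : 'I_n) : (i < m)%N -> g' i = g i by rewrite /g' => ->.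
have gX (j : 'I_n) X : (j <= m)%N -> admissible j X -> gammaX g' X = gammaX g X.
  by move=> jm; apply: eq_gammaX => i ij; apply: gg'; apply: leq_trans ij jm.
exists g' => j; rewrite ltnS leq_eqVlt => /orP[/eqP jm|jm].
  have adm0 : admissible j set0 by rewrite /admissible sub0set cards0.
  have le_jm : (j <= m)%N by rewrite jm.
  have : g' j = gammaX g [arg min_(X < set0 | admissible j X) gammaX g X]%O.
    by rewrite /g' jm ltnn.
  case: arg_minP => // X admX minX g'j; split.
    by exists X => //; rewrite g'j (gX j).
  by move=> Y admY; rewrite g'j (gX j) // minX.
have [[X admX gj] minX] := gP j jm; split.
  by exists X => //; rewrite gg' // (gX j) // ltnW.
by move=> Y admY; rewrite gg' // (gX j) ?minX // ltnW.
Qed.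

End Coefficients.

(* Main.v *)
(* Sequential lifting. For a support S with an item > p, take its last item j  *)
(* and X = S \ {j}: the minimality of gamma_j compared with gamma^X is exactly *)
(* the lifted inequality at S; supports inside [p] are covered by the original *)
(* inequality. For the dimension, the p+1 affinely independent points of the   *)
(* original facet, padded with zeros, are completed by one tight point for     *)
(* each j > p, with support X + {j} for a minimizing X: as X precedes j, each  *)
(* new point is independent of the previous ones.                              *)

Require Import Defs.
From HB Require Import structures.
From mathcomp Require Import boolp classical_sets reals convex.
From mathcomp Require Import interval_inference.
From mathcomp Require Import all_boot all_order all_algebra.

Set Implicit Arguments.
Unset Strict Implicit.
Unset Printing Implicit Defensive.

Import Order.TTheory GRing.Theory Num.Theory.
Local Open Scope ring_scope.

(* Unqualified, [point] is the base point of a pointedType. *)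
Local Notation point := Defs.point.

(** Let c be the vector [lifted_coef]. By [gammaXE], gamma^X = f(a_L + a(X)) - c(X), where a(X) and
    c(X) sum the entries over X. That gamma_j is a lower bound of these values means c(S) <= f(a(S))
    for every S of at most k items whose last item j exceeds p ([lifted_valid_low]); that it is
    attained yields a tight point whose last item is j ([lifted_tight]). On supports inside [p] the
    form is the separation inequality itself.

    Both hulls are full-dimensional ([has_dim_conv_hull_P2]), so the given facet carries p+1
    affinely independent tight points. The n-p new tight points raise this to n+1, the most that a
    hyperplane of R x R^n can hold ([facet_lifting]). *)

Section AffineIndependence.
Variables (R : realType) (V : vectType R).
Implicit Types (s t : seq V) (u v z : V).

(** * Affine independence and dimension *)

Lemma size_aff_indep s : aff_indep s -> (size s <= (dim V).+1)%N.
Proof.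
case: s => // v t; rewrite /aff_indep /= => /eqP tP.
by rewrite ltnS -(size_map (fun u => u - v)) -tP -dimvf dimvS ?subvf.
Qed.

(** All differences u - v lie in the kernel of [phi], while z - v does not. The new point goes
    second because [aff_indep] subtracts the head, so the base point v is kept. *)
Lemma aff_indep_insert (phi : V -> R^o) v z t :
  linear phi -> aff_indep (v :: t) -> {in t, forall u, phi u = phi v} ->
  phi z != phi v -> aff_indep [:: v, z & t].
Proof.
move=> phi_lin; rewrite /aff_indep /= free_cons => -> phit phiz; rewrite andbT.
pose l : {linear V -> R^o} :=
  HB.pack phi (GRing.isLinear.Build _ _ _ _ phi phi_lin).
have phiB x y : phi (x - y) = phi x - phi y := raddfB l x y.
apply: contra phiz => zv.
have kt : (<<[seq u - v | u <- t]>> <= lker (linfun l))%VS.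
  apply/span_subvP => _ /mapP[u ut ->].
  by rewrite memv_ker lfunE /= phiB subr_eq0; apply/eqP; apply: phit.
by have /(subvP kt) := zv; rewrite memv_ker lfunE /= phiB subr_eq0.
Qed.

(** Moving the base point v along e leaves the hyperplane, so e + v can still be inserted into the
    family. *)
Lemma size_aff_indep_hyperplane (phi : V -> R^o) (b : R) e s :
  linear phi -> phi e != 0 -> aff_indep s -> {in s, forall u, phi u = b} ->
  (size s <= dim V)%N.
Proof.
case: s => // v t phi_lin phie svt phis.
have := @aff_indep_insert phi v (e + v) t phi_lin svt.
move=> /(_ _ _)/size_aff_indep; rewrite !ltnS; apply.
  by move=> u ut; rewrite (phis u) ?(phis v) ?inE ?eqxx ?ut ?orbT.
have := phi_lin 1 e v; rewrite !scale1r => ->.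
by rewrite -subr_eq0 addrK.
Qed.

Lemma has_dim_inj (A : set V) d e : has_dim A d -> has_dim A e -> d = e.
Proof.
move=> [[s [ss sI sA]] dM] [[t [ts tI tA]] eM].
by apply/eqP; rewrite eqn_leq -ltnS -ss eM // -ltnS -ts dM.
Qed.

End AffineIndependence.

Lemma map_aff_indep (R : realType) (V W : vectType R) (h : {linear V -> W})
    (s : seq V) :
  injective h -> aff_indep s -> aff_indep (map h s).
Proof.
move=> h_inj; case: s => [|v t]; first by rewrite /aff_indep /= !nil_free.
rewrite /aff_indep /= /free => /eqP tI.
have -> : [seq u - h v | u <- map h t]
          = map (linfun h) [seq u - v | u <- t].
  by rewrite -!map_comp; apply: eq_map => u /=; rewrite lfunE /= raddfB.
have kh : lker (linfun h) == 0%VS.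
  by apply/lker0P => x y; rewrite !lfunE; apply: h_inj.
by rewrite -limg_span limg_dim_eq ?(eqP kh) ?capv0 // tI !size_map.
Qed.

(** * Linear forms on R x R^m, padding by zeros, and lifting of facets *)

Section Points.
Variable R : realType.

Definition lform m (c x : 'rV[R]_m) : R := \sum_(i < m) c 0 i * x 0 i.

(** The slack of the inequality; its kernel is the hyperplane that cuts out the face. *)
Definition gap m (c : 'rV[R]_m) (z : point R m) : R^o := z.1 - lform c z.2.

Lemma gap_is_linear m (c : 'rV[R]_m) : linear (gap c).
Proof.
move=> t x y; rewrite /gap /lform /= scalerBr scaler_sumr.
rewrite addrACA -opprD -big_split /=; congr (_ - _).
by apply: eq_bigr => i _; rewrite !mxE mulrDr mulrCA.
Qed.

HB.instance Definition _ m (c : 'rV[R]_m) :=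
  GRing.isLinear.Build R (point R m) R^o *:%R (gap c) (gap_is_linear c).

Definition coordinate m (j : 'I_m) (z : point R m) : R^o := z.2 0 j.

Lemma coordinate_is_linear m (j : 'I_m) : linear (coordinate j).
Proof. by move=> t x y; rewrite /coordinate !mxE. Qed.

Definition embed p r (z : point R p) : point R (p + r) := (z.1, row_mx z.2 0).

Fact embed_is_linear p r : linear (@embed p r).
Proof.
move=> t x y; apply/pair_equal_spec; rewrite /= scale_row_mx add_row_mx.
by rewrite scaler0 addr0.
Qed.

HB.instance Definition _ p r :=
  GRing.isLinear.Build R (point R p) (point R (p + r)) *:%R (@embed p r)
    (embed_is_linear r).

Lemma embed_inj p r : injective (@embed p r).
Proof. by move=> [w x] [w' y] [-> /eq_row_mx[-> _]]. Qed.

Lemma lform_embed p r (c : 'rV[R]_(p + r)) (x : 'rV_p) :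
  lform c (row_mx x 0) = lform (lsubmx c) x.
Proof.
rewrite /lform big_split_ord /= [X in _ + X]big1 ?addr0 => [|i _].
  by apply: eq_bigr => i _; rewrite row_mxEl mxE.
by rewrite row_mxEr mxE mulr0.
Qed.

Lemma dim_point m : dim (point R m) = m.+1.
Proof. by rewrite -[LHS]/(1 + 1 * m)%N mul1n. Qed.

(* Each new point is the first with a nonzero j-th coordinate, so it lies off  *)
(* the hyperplane x_j = 0 that contains its predecessors.                      *)
Lemma extend_aff_indep n (A : set (point R n)) m v t :
  (m <= n)%N -> aff_indep (v :: t) -> {in v :: t, forall z, A z} ->
  {in v :: t, forall (z : point R n) (i : 'I_n),
     (m <= i)%N -> z.2 0 i = 0} ->
  (forall j : 'I_n, (m <= j)%N -> exists2 z : point R n, A z &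
     z.2 0 j != 0 /\ forall i : 'I_n, (j < i)%N -> z.2 0 i = 0) ->
  exists s, [/\ size s = (size (v :: t) + (n - m))%N, aff_indep s &
                forall z, z \in s -> A z].
Proof.
move=> + + + + step; move dn: (n - m)%N => d.
elim: d => [|d IH] in m t dn step *.
  by move=> mn tI tA _; exists (v :: t); rewrite addn0.
move=> mn tI tA tz; have mn' : (m < n)%N by rewrite -subn_gt0 dn.
pose j := Ordinal mn'; have [z zA [zj zi]] := step j (leqnn m).
have [|i mi|||u|u|s [ss sI sA]] := IH m.+1 (z :: t).
- by rewrite subnS dn.
- by apply: step; apply: ltnW.
- by [].
- apply: (aff_indep_insert (phi := coordinate j)) => //; rewrite /coordinate.
    exact: coordinate_is_linear.
    by move=> u ut; rewrite (tz u) ?(tz v) ?inE ?eqxx ?ut ?orbT.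
  by rewrite (tz v) ?inE ?eqxx.
- rewrite !inE orbCA => /predU1P[->//|uvt].
  by apply: tA; rewrite inE.
- rewrite !inE orbCA => /predU1P[->|uvt] i mi; first exact: zi.
  by apply: tz; rewrite ?inE // ltnW.
by exists s; split=> //; rewrite ss /= !addnS !addSn.
Qed.

Lemma conv_hull_lform m (A : set (point R m)) (c : 'rV[R]_m) :
  (forall z, A z -> lform c z.2 <= z.1) ->
  forall z, conv_hull A z -> lform c z.2 <= z.1.
Proof.
move=> AP; pose H := [set z : point R m | lform c z.2 <= z.1]%classic.
apply: (@smallest_sub _ _ _ H); last exact: AP.
move=> x y t /set_mem x0 /set_mem y0; apply/mem_set.
(* The abstract [conv] is by definition the combination with weights t and 1 - t, to which linearity
   applies. *)
rewrite [conv t x y]/(t%:num *: (x : point R m)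
                      + (1 - t%:num) *: (y : point R m)).
have gapE u : H u <-> 0 <= gap c u by rewrite subr_ge0.
apply/gapE; move/gapE: x0 => x0; move/gapE: y0 => y0.
rewrite linearP linearZ.
by rewrite addr_ge0 ?mulr_ge0 // subr_ge0.
Qed.

(** The preimage of a convex set under a linear map is convex. *)
Lemma conv_hull_embed p r (A : set (point R p)) (B : set (point R (p + r))) :
  (forall z, A z -> B (embed r z)) ->
  forall z, conv_hull A z -> conv_hull B (embed r z).
Proof.
move=> AB; pose H := [set z | conv_hull B (embed r z)]%classic.
apply: (@smallest_sub _ _ _ H).
  move=> x y t /set_mem x0 /set_mem y0; apply/mem_set => X XB.
  have [cX _] := XB; have := cX _ _ t (mem_set (x0 X XB)) (mem_set (y0 X XB)).
  move/set_mem; rewrite /= [conv t x y]/(t%:num *: (x : point R p)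
                                         + (1 - t%:num) *: (y : point R p)).
  by rewrite linearP linearZ.
by move=> z /AB; apply: sub_gen_smallest.
Qed.

Lemma facet_lifting p r (C : set (point R p)) (D : set (point R (p + r)))
    (c : 'rV[R]_(p + r)) :
  has_dim C p.+1 -> has_dim D (p + r).+1 ->
  (forall z, C z -> D (embed r z)) ->
  (forall z, D z -> lform c z.2 <= z.1) ->
  (forall j : 'I_(p + r), (p <= j)%N ->
     exists2 z, D z /\ z.1 = lform c z.2 &
       z.2 0 j != 0 /\ forall i : 'I_(p + r), (j < i)%N -> z.2 0 i = 0) ->
  facet_defining C (lform (lsubmx c)) -> facet_defining D (lform c).
Proof.
(* Uniqueness of the dimension of C forces d = p. *)
move=> dimC dimD CD validD step [_ [d [/(has_dim_inj dimC)[<-] [faceC _]]]].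
split=> //; exists (p + r)%N; split=> //; split; last first.
  (* The face lies in the hyperplane of zero gap, and the direction (1, 0) leaves it since its gap
     is 1. *)
  move=> s sI sF; rewrite -(dim_point (p + r)).
  apply: (@size_aff_indep_hyperplane _ _ (gap c) 0 (1, 0)) => //
    [||z /sF[_ zl]].
      exact: gap_is_linear.
    rewrite /gap /lform big1 /= ?subr0 ?oner_neq0 // => i _.
    by rewrite mxE mulr0.
  by rewrite /gap zl subrr.
have [[|v t] [] // [st] sI sF] := faceC.
have [||u|u|//|s [ss sI' sF']] := @extend_aff_indep (p + r)
   [set z | D z /\ z.1 = lform c z.2]%classic p (embed r v) (map (embed r) t).
- exact: leq_addr.
- exact: (@map_aff_indep _ _ _ (@embed p r) (v :: t) (@embed_inj p r) sI).
- rewrite -[_ :: _]/(map (embed r) (v :: t)) => /mapP[z zs ->].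
  have [Cz zl] := sF z zs; split; first exact: CD.
  by rewrite /= lform_embed.
- rewrite -[_ :: _]/(map (embed r) (v :: t)) => /mapP[z zs ->] i pi.
  rewrite /= mxE; case: split_ordP => k ik; last by rewrite mxE.
  by move: pi; rewrite ik leqNgt /= ltn_ord.
by exists s; split=> //; rewrite ss /= size_map st addKn addSn.
Qed.

End Points.

(** * Binary points as item sets; full dimension of the hull *)

Section Indicators.
Variable R : realType.

Definition indic m (S : {set 'I_m}) : 'rV[R]_m := \row_i (i \in S)%:R.

Lemma lform_indic m (c : 'rV[R]_m) (S : {set 'I_m}) :
  lform c (indic S) = \sum_(i in S) c 0 i.
Proof.
rewrite /lform [RHS]big_mkcond; apply: eq_bigr => i _.
by rewrite mxE; case: (i \in S); rewrite ?mulr1 ?mulr0.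
Qed.

Lemma binary_indic m (x : 'rV[R]_m) : binary x -> exists S, x = indic S.
Proof.
move=> xb; exists [set i | x 0 i == 1]; apply/rowP => i; rewrite mxE inE.
by case: (xb i) => ->; rewrite ?eqxx // eq_sym oner_eq0.
Qed.

Lemma P2_indic f k m (a : 'rV[R]_m) w (S : {set 'I_m}) :
  P2 f k a (w, indic S) <-> f (\sum_(i in S) a 0 i) <= w /\ (#|S| <= k)%N.
Proof.
rewrite -lform_indic -(ler_nat R) -sumr_const.
have -> : \sum_(i in S) 1 = \sum_i indic S 0 i.
  rewrite big_mkcond; apply: eq_bigr => i _.
  by rewrite mxE; case: (i \in S).
split=> [[_ ? ?]|[? ?]]; split=> // i.
by rewrite mxE; case: (i \in S); [right|left].
Qed.

Lemma P1E f k p (aH : R) : P1 f k (p := p) aH = P2 f k (const_mx aH).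
Proof.
have sumE (x : 'rV[R]_p) :
    \sum_i (const_mx aH : 'rV_p) 0 i * x 0 i = aH * \sum_i x 0 i.
  by rewrite mulr_sumr; apply: eq_bigr => i _; rewrite mxE.
by apply/seteqP; split=> z [? zf ?]; split; rewrite // ?sumE // -sumE.
Qed.

Lemma has_dim_conv_hull_P2 f k m (a : 'rV[R]_m) :
  (1 <= k)%N -> f 0 = 0 -> has_dim (conv_hull (P2 f k a)) m.+1.
Proof.
move=> k1 f0; split; last first.
  by move=> s sI _; rewrite -(dim_point R m) size_aff_indep.
have set0E : indic set0 = 0 :> 'rV[R]_m by apply/rowP => i; rewrite !mxE inE.
have hull w (S : {set 'I_m}) : f (\sum_(i in S) a 0 i) <= w -> (#|S| <= k)%N ->
    conv_hull (P2 f k a) (w, indic S).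
  by move=> *; apply: sub_gen_smallest; apply/P2_indic.
have hull0 w : 0 <= w -> conv_hull (P2 f k a) (w, 0).
  by move=> w0; rewrite -set0E; apply: hull; rewrite ?big_set0 ?f0 ?cards0.
(* Two points of empty support settle the w-direction; the singletons, feasible as k >= 1, then add
   one coordinate each. *)
have [//||z|z|j _|s [ss sI sA]] :=
    @extend_aff_indep R m (conv_hull (P2 f k a)) 0 (0, 0) [:: (1, 0)].
- rewrite /aff_indep /= seq1_free subr0; apply/eqP => -[/eqP].
  by rewrite oner_eq0.
- by rewrite !inE => /orP[] /eqP->; apply: hull0.
- by rewrite !inE => /orP[] /eqP-> i _; rewrite mxE.
- exists (f (a 0 j), indic [set j]).
    by apply: hull; rewrite ?big_set1 ?cards1.
  split=> [|i ji]; rewrite mxE inE ?eqxx ?oner_neq0 //.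
  by rewrite gt_eqF.
by exists s; split=> //; rewrite ss subn0.
Qed.

End Indicators.

(** * Validity and tightness from the minimality of gamma *)

Section Lifting.
Variables (R : realType) (f : R -> R) (k i0 n p : nat) (aH aL : R).
Variables (a : 'rV[R]_n) (gamma : 'I_n -> R).

Definition lifted_coef : 'rV[R]_n :=
  \row_i (if (i < i0)%N then rho f aH i.+1
          else if (i < p)%N then psi f k i0 aH else gamma i).

Lemma sum_lifted_coef (S : pred 'I_n) (y : 'I_n -> R) : (i0 <= p)%N ->
  \sum_(i | S i) lifted_coef 0 i * y i =
  \sum_(i | S i && (i < i0)%N) rho f aH i.+1 * y i
  + \sum_(i | S i && (i0 <= i < p)%N) psi f k i0 aH * y i
  + \sum_(i | S i && (p <= i)%N) gamma i * y i.
Proof.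
move=> i0p; rewrite (bigID (fun i : 'I_n => (i < i0)%N)) /= -addrA.
congr (_ + _).
  by apply: eq_bigr => i /andP[_ ii0]; rewrite mxE ii0.
rewrite (bigID (fun i : 'I_n => (i < p)%N)) /=; congr (_ + _).
  apply: eq_big => [i|i /andP[/andP[_ ii0] ip]]; first by rewrite -leqNgt andbA.
  by rewrite mxE (negbTE ii0) ip.
apply: eq_big => [i|i /andP[/andP[_ ii0] ip]].
  rewrite -!leqNgt -andbA; congr (_ && _); apply: andb_idl.
  exact: leq_trans.
by rewrite mxE (negbTE ii0) (negbTE ip).
Qed.

Lemma gammaXE (X : {set 'I_n}) : (i0 <= p)%N ->
  gammaX f k i0 aH p a aL gamma X
  = f (aL + \sum_(i in X) a 0 i) - \sum_(i in X) lifted_coef 0 i.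
Proof.
move=> i0p.
have -> : \sum_(i in X) lifted_coef 0 i = \sum_(i in X) lifted_coef 0 i * 1.
  by apply: eq_bigr => i _; rewrite mulr1.
rewrite (sum_lifted_coef _ (fun=> 1)) // !opprD !addrA /gammaX.
by congr (_ - _ - _ - _); apply: eq_bigr => i _; rewrite mulr1.
Qed.

Hypotheses (k_ge1 : (1 <= k)%N) (i0_le_p : (i0 <= p)%N).
Hypothesis a_low : forall i : 'I_n, (p <= i)%N -> a 0 i = aL.
Hypothesis gammaP : exact_lifting f k i0 aH p a aL gamma.

Let lifted_coef_low (j : 'I_n) : (p <= j)%N -> lifted_coef 0 j = gamma j.
Proof.
by move=> pj; rewrite mxE !ltnNge pj (leq_trans i0_le_p pj).
Qed.

Lemma lifted_valid_low (S : {set 'I_n}) (i : 'I_n) :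
  (#|S| <= k)%N -> i \in S -> (p <= i)%N ->
  \sum_(j in S) lifted_coef 0 j <= f (\sum_(j in S) a 0 j).
Proof.
move=> Sk iS pi.
(* Taking the last item j makes S \ {j} admissible for j. *)
have [j jS jmax] := arg_maxnP (P := fun j => j \in S) (@nat_of_ord n) iS.
have pj : (p <= j)%N by apply: leq_trans pi (jmax _ iS).
have admX : admissible k j (S :\ j).
  apply/andP; split; last first.
    by rewrite -ltnS prednK //; move: Sk; rewrite (cardsD1 j) jS.
  apply/subsetP => l; rewrite !inE => /andP[lj lS].
  by rewrite ltn_neqAle lj; apply: jmax.
have [_ /(_ _ admX)] := gammaP pj.
rewrite gammaXE // lerBrDr -lifted_coef_low // -(a_low pj).
by rewrite !(big_setD1 j jS).
Qed.

Lemma lifted_tight (j : 'I_n) : (p <= j)%N ->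
  exists2 z : Defs.point R n, P2 f k a z /\ z.1 = lform lifted_coef z.2 &
    z.2 0 j != 0 /\ forall i : 'I_n, (j < i)%N -> z.2 0 i = 0.
Proof.
move=> pj; have [[X /andP[/subsetP Xj Xk] gX] _] := gammaP pj.
have jX : j \notin X by apply/negP => /Xj; rewrite inE ltnn.
exists (f (aL + \sum_(i in X) a 0 i), indic _ (j |: X)); split=> /=.
- apply/P2_indic; rewrite big_setU1 //= a_low // cardsU1 jX add1n.
  by rewrite -(prednK k_ge1) ltnS.
- rewrite lform_indic big_setU1 //= lifted_coef_low // gX gammaXE //.
  by rewrite subrK.
- by rewrite mxE setU11 oner_neq0.
- move=> i ji; rewrite mxE !inE gt_eqF //=; case: (boolP (i \in X)) => // /Xj.
  by rewrite inE ltnNge ltnW.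
Qed.

End Lifting.

Theorem corollary4p16p1 (R : realType) (n k p i0 : nat) (f : R -> R)
    (a : 'rV[R]_n) (aL aH : R) (gamma : 'I_n -> R)
    (k_ge1 : (1 <= k)%N)
    (f_concave : concave_function f) (f0 : f 0 = 0)
    (aL_ge0 : 0 <= aL) (aL_lt_aH : aL < aH)
    (k_lt_p : (k < p)%N) (p_lt_n : (p < n)%N)
    (a_high : forall i : 'I_n, (i < p)%N -> a 0 i = aH)
    (a_low : forall i : 'I_n, (p <= i)%N -> a 0 i = aL)
    (i0_lt_k : (i0 < k)%N)
    (i0_cond : f (aL + (i0%:R + 1) * aH) - f (aL + i0%:R * aH)
               <= (f (k%:R * aH) - f (i0%:R * aH)) / (k%:R - i0%:R))
    (gammaP : exact_lifting f k i0 aH p a aL gamma)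
    (SI_facet :
       facet_defining (conv_hull (P1 f k (p := p) aH))
         (fun x : 'rV[R]_p =>
            \sum_(i < p | (i < i0)%N) rho f aH i.+1 * x 0 i
            + \sum_(i < p | (i0 <= i)%N) psi f k i0 aH * x 0 i)) :
  facet_defining (conv_hull (P2 f k a))
    (fun x : 'rV[R]_n =>
       \sum_(i < n | (i < i0)%N) rho f aH i.+1 * x 0 i
       + \sum_(i < n | (i0 <= i < p)%N) psi f k i0 aH * x 0 i
       + \sum_(j < n | (p <= j)%N) gamma j * x 0 j).
Proof.
(* With n = p + r the high items form the left block of a row vector. *)
have [r nE] : exists r, n = (p + r)%N.
  by exists (n - p)%N; rewrite subnKC // ltnW.
subst n; have i0p : (i0 <= p)%N by rewrite ltnW // (ltn_trans i0_lt_k).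
set c := lifted_coef f k i0 p aH gamma.
have -> : (fun x : 'rV[R]_(p + r) =>
       \sum_(i < p + r | (i < i0)%N) rho f aH i.+1 * x 0 i
       + \sum_(i < p + r | (i0 <= i < p)%N) psi f k i0 aH * x 0 i
       + \sum_(j < p + r | (p <= j)%N) gamma j * x 0 j) = lform c.
  by apply/funext => x; rewrite /lform sum_lifted_coef.
have lE (x : 'rV[R]_p) : lform (lsubmx c) x =
    \sum_(i < p | (i < i0)%N) rho f aH i.+1 * x 0 i
    + \sum_(i < p | (i0 <= i)%N) psi f k i0 aH * x 0 i.
  rewrite /lform (bigID (fun i : 'I_p => (i < i0)%N)) /=; congr (_ + _).
    by apply: eq_bigr => i ii0; rewrite !mxE /= ii0.
  apply: eq_big => [i|i ii0]; first by rewrite -leqNgt.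
  by rewrite !mxE /= (negbTE ii0) ltn_ord.
(* Seen as a [P2] with constant weights, [P1] gets its dimension from the same lemma. *)
rewrite -(funext lE) P1E in SI_facet.
have embedP z : P2 f k (const_mx aH) z <-> P2 f k a (embed r z).
  case: z => w x; rewrite /P2 /embed /=.
  have -> : \sum_(i < p + r) (row_mx x 0) 0 i = \sum_(i < p) x 0 i.
    rewrite big_split_ord /= [X in _ + X]big1 ?addr0 => [|i _].
      by apply: eq_bigr => i _; rewrite row_mxEl.
    by rewrite row_mxEr mxE.
  have -> : \sum_(i < p + r) a 0 i * (row_mx x 0) 0 i
            = \sum_(i < p) (const_mx aH : 'rV_p) 0 i * x 0 i.
    rewrite -/(lform a (row_mx x 0)) lform_embed; apply: eq_bigr => i _.
    by rewrite !mxE a_high /=.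
  split=> -[xb ? ?]; split=> // i.
    by rewrite mxE; case: splitP => l _; [exact: xb | rewrite mxE; left].
  by have := xb (lshift r i); rewrite row_mxEl.
have [SI_valid _] := SI_facet.
apply: facet_lifting SI_facet.
- exact: has_dim_conv_hull_P2.
- exact: has_dim_conv_hull_P2.
- by apply: conv_hull_embed => z /embedP.
- apply: conv_hull_lform => -[w x] xP.
  have [xb _ _] := xP; have [S xS] := binary_indic xb.
  rewrite /= in xS; rewrite xS in xP *.
  have [fw Sk] := (P2_indic _ _ _ _ _).1 xP.
  have [[i /andP[iS pi]]|S_high] := pselect (exists i, (i \in S) && (p <= i)%N).
    rewrite lform_indic; apply: le_trans fw.
    exact: (lifted_valid_low k_ge1 i0p a_low gammaP Sk iS pi).
  (* No item of S exceeds p, so the point is a padded point of [P1], where the separation inequality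
     is valid. *)
  have xE : indic R S = row_mx (lsubmx (indic R S)) 0.
    rewrite -[LHS]hsubmxK; congr row_mx; apply/rowP => i; rewrite !mxE.
    case: (boolP (_ \in S)) => // iS; case: S_high.
    by exists (rshift p i); rewrite iS leq_addr.
  rewrite xE in xP *; rewrite lform_embed.
  apply: (SI_valid (w, _)); apply: sub_gen_smallest; exact/embedP.
- move=> j /(lifted_tight k_ge1 i0p a_low gammaP)[z [zP zl] zj].
  by exists z => //; split=> //; apply: sub_gen_smallest.
Qed.
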